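(* Let $X$ be a complex Banach space, $\tau>0$, and let $A_{0}:\mathcal{D}(A_{0})\subseteq X\to X$ be the infinitesimal generator of a strongly continuous group $\{\mathcal{T}(t)\}_{t\in\mathbb{R}}$ of bounded linear operators on $X$. If $\{\mathcal{T}(t)\}_{t\in\mathbb{R}}$ commutes with $A_{1}\in\mathcal{L}(X)$ (i.e. $\mathcal{T}(t)A_1=A_1\mathcal{T}(t)$ for all $t\in\mathbb{R}$), then the fundamental solution $\mathcal{S}(t;\tau)$ of $\frac{\mathrm{d}}{\mathrm{d}t}u(t)=A_{0}u(t)+A_{1}u(t-\tau)$, which satisfies $\mathcal{S}(t;\tau)=\Theta$ for $-\tau\le t<0$ and $\mathcal{S}(0;\tau)=I$, has the following closed form for $t\ge 0$: $$\mathcal{S}(t;\tau)=\sum_{n=0}^{\infty}\big[A_{1}\mathcal{T}(\tau)^{-1}\big]^{n}\frac{(t-n\tau)^{n}}{n!}\mathbf{1}_{t\ge n\tau}\,\mathcal{T}(t)=\mathcal{T}(t)\sum_{n=0}^{\infty}\big[A_{1}\mathcal{T}(\tau)^{-1}\big]^{n}\frac{(t-n\tau)^{n}}{n!}\mathbf{1}_{t\ge n\tau}.$$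
   Context: $I$ and $\Theta$ are the identity and zero operators on $X$. $\mathbf{1}_{t\ge n\tau}$ equals $1$ if $t\ge n\tau$ and $0$ otherwise. The fundamental solution $\mathcal{S}(\cdot;\tau):[-\tau,\infty)\to\mathcal{L}(X)$ is the operator family satisfying $\frac{\mathrm{d}}{\mathrm{d}t}\mathcal{S}(t;\tau)=A_{0}\mathcal{S}(t;\tau)+A_{1}\mathcal{S}(t-\tau;\tau)$ for $t\ge 0$, with $\mathcal{S}(t;\tau)=\Theta$ for $-\tau\le t<0$ and $\mathcal{S}(0;\tau)=I$; it is given explicitly by the delayed Dyson–Phillips series $\mathcal{S}(t;\tau)=\sum_{n\ge 0}S_{n}(t,n\tau)\mathbf{1}_{t\ge n\tau}$ for $t\ge 0$, where $S_{0}(t,0)=\mathcal{T}(t)$ and $S_{n}(t,n\tau)=\int_{n\tau}^{t}\mathcal{T}(t-s)A_{1}S_{n-1}(s-\tau,(n-1)\tau)\,\mathrm{d}s$ for $t\ge n\tau$, $n\in\mathbb{N}$ (integrals in the strong operator topology). *)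

(* Defs.v *)
From Stdlib Require Import Reals Factorial.
From Coquelicot Require Import Coquelicot.
Open Scope R_scope.

(* Real integrals and derivatives of functions R -> X, for X a complex Banach
   space, live in the real Banach space obtained from X by restriction of
   scalars.  Carrier, topology and norm are unchanged. *)
Section Realify.
Variable X : CompleteNormedModule C_AbsRing.

Definition realify_scal (r : R) (x : X) : X := scal (RtoC r : C_AbsRing) x.

Lemma realify_scal_assoc (r s : R) (x : X) :
  realify_scal r (realify_scal s x) = realify_scal (r * s) x.
Proof. unfold realify_scal. rewrite scal_assoc, RtoC_mult. reflexivity. Qed.

Lemma realify_scal_one (x : X) : realify_scal 1 x = x.
Proof. exact (scal_one x). Qed.

Lemma realify_scal_distr_l (r : R) (x y : X) :
  realify_scal r (plus x y) = plus (realify_scal r x) (realify_scal r y).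
Proof. exact (scal_distr_l (RtoC r : C_AbsRing) x y). Qed.

Lemma realify_scal_distr_r (r s : R) (x : X) :
  realify_scal (r + s) x = plus (realify_scal r x) (realify_scal s x).
Proof.
unfold realify_scal. rewrite RtoC_plus.
exact (scal_distr_r (RtoC r : C_AbsRing) (RtoC s) x).
Qed.

Lemma realify_norm_scal (r : R) (x : X) :
  norm (realify_scal r x) <= Rabs r * norm x.
Proof. rewrite <- Cmod_R. exact (norm_scal (RtoC r : C_AbsRing) x). Qed.

Definition realify_ModuleSpace_mixin :=
  ModuleSpace.Mixin R_Ring (CompleteNormedModule.AbelianGroup _ X) realify_scal
    realify_scal_assoc realify_scal_one realify_scal_distr_l
    realify_scal_distr_r.

Definition realify_aux : NormedModuleAux R_AbsRing :=
  NormedModuleAux.Pack R_AbsRing X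
    (NormedModuleAux.Class R_AbsRing X
       (ModuleSpace.Class R_Ring X
          (AbelianGroup.class (CompleteNormedModule.AbelianGroup _ X))
          realify_ModuleSpace_mixin)
       (UniformSpace.class (CompleteNormedModule.UniformSpace _ X)))
    X.

Definition realify_NormedModule_mixin : NormedModule.mixin_of R_AbsRing realify_aux :=
  NormedModule.Mixin R_AbsRing realify_aux
    (fun x : X => norm x) (norm_factor (V := X))
    (fun x y : X => norm_triangle x y) realify_norm_scal
    (fun x y : X => norm_compat1 x y) (fun x y : X => norm_compat2 x y)
    (fun x : X => norm_eq_zero x).

Definition realify : CompleteNormedModule R_AbsRing :=
  CompleteNormedModule.Pack R_AbsRing X
    (CompleteNormedModule.Class R_AbsRing X
       (NormedModule.Class R_AbsRing X _ realify_NormedModule_mixin)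
       (CompleteNormedModule.mixin _ _ (CompleteNormedModule.class _ X)))
    X.

End Realify.

(* Bounded operators on X are functions X -> X satisfying Coquelicot's
   [is_linear], which includes boundedness.  An unbounded operator is a pair of
   a domain D : X -> Prop and a function A : X -> X, of which only the values
   on D matter. *)

Record is_C0_group (X : CompleteNormedModule C_AbsRing) (T : R -> X -> X)
  : Prop := {
  C0_group_linear : forall t, is_linear (T t);
  C0_group_0 : forall x, T 0 x = x;
  C0_group_plus : forall s t x, T (s + t) x = T s (T t x);
  C0_group_continuous : forall x t,
    filterlim (fun s => T s x) (locally t) (locally (T t x)) }.

Definition is_generator (X : CompleteNormedModule C_AbsRing)
  (T : R -> X -> X) (D : X -> Prop) (A : X -> X) : Prop :=
  (forall x, D x <->
     exists y, is_derive (V := realify X) (fun t => T t x) 0 y) /\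
  (forall x, D x -> is_derive (V := realify X) (fun t => T t x) 0 (A x)).

(* The equation is understood in the strong sense, on vectors of the domain of
   the generator.  The derivative is the right-hand one: t |-> S t x jumps at 0,
   so that it has no two-sided derivative at 0 and, because of the delayed
   term, none at tau either. *)
Record is_fundamental_solution (X : CompleteNormedModule C_AbsRing) (tau : R)
  (D : X -> Prop) (A0 A1 : X -> X) (S : R -> X -> X) : Prop := {
  fundamental_linear : forall t, - tau <= t -> is_linear (S t);
  fundamental_history : forall t x, - tau <= t < 0 -> S t x = zero;
  fundamental_init : forall x, S 0 x = x;
  fundamental_continuous : forall x t, 0 <= t ->
    filterlim (fun s => S s x) (within (fun s => 0 <= s) (locally t))
      (locally (S t x));
  fundamental_equation : forall x t, D x -> 0 <= t ->
    D (S t x) /\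
    filterlim
      (fun h => scal (RtoC (/ h) : C_AbsRing) (minus (S (t + h) x) (S t x)))
      (at_right 0)
      (locally (plus (A0 (S t x)) (A1 (S (t - tau) x)))) }.

Definition indicator_ge (t a : R) : R := if Rle_dec a t then 1 else 0.

(* [dyson_phillips T A1 tau n t] is S_n(t, n tau). *)
Fixpoint dyson_phillips (X : CompleteNormedModule C_AbsRing) (T : R -> X -> X)
  (A1 : X -> X) (tau : R) (n : nat) (t : R) (x : X) : X :=
  match n with
  | O => T t x
  | S m => RInt (V := realify X)
      (fun s => T (t - s) (A1 (dyson_phillips X T A1 tau m (s - tau) x)))
      (INR n * tau) t
  end.

(* Convergence of a series of operators in operator norm. *)
Definition is_op_series (X : CompleteNormedModule C_AbsRing)
  (F : nat -> X -> X) (B : X -> X) : Prop :=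
  forall eps : R, 0 < eps ->
  eventually (fun N => forall x : X,
    norm (minus (sum_n (fun n => F n x) N) (B x)) <= eps * norm x).

(* The inverse of a bijection of X (unspecified if F is not bijective). *)
Definition op_inv (X : CompleteNormedModule C_AbsRing) (F : X -> X) (y : X) : X :=
  iota (fun x => F x = y).

Definition closed_form_term (X : CompleteNormedModule C_AbsRing)
  (T : R -> X -> X) (A1 : X -> X) (tau t : R) (n : nat) (x : X) : X :=
  scal (RtoC ((t - INR n * tau) ^ n / INR (fact n)
              * indicator_ge t (INR n * tau)) : C_AbsRing)
    (Nat.iter n (fun y => A1 (op_inv X (T tau) y)) x).

(* Main.v *)
Require Import Defs.
From Corelib Require Import ssreflect.
From Stdlib Require Import Reals ZArith Lra Lia Classical ClassicalEpsilon.
From Coquelicot Require Import Coquelicot.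
Open Scope R_scope.

(** Because [A1] commutes with the group, the integrand defining [S_n] is a
    polynomial weight times the fixed vector [A1^n T(t - n tau) x], so that
    [S_n(t, n tau) = (t - n tau)^n / n! A1^n T(t - n tau)], which is also the
    n-th term of the closed form. For fixed [t] only the terms with
    [n tau <= t] survive, and the finite sum solves the equation because the
    derivative of the n-th weight at [t] is the (n-1)-st weight at [t - tau].
    Conversely, the difference [v] of two solutions starting in the domain
    satisfies [v' = A0 v] on each step of length [tau]; then [T(b - s) v(s)] has
    zero right derivative, so [v = 0], and density of the domain extends this to
    all vectors. The differentiation of [T(b - s) v(s)] needs [T] to be locally
    bounded, hence the uniform boundedness principle. *)

(** * Uniform boundedness *)

Lemma minus_minus_plus {G : AbelianGroup} (x y z : G) :
  minus x z = plus (minus x y) (minus y z).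
Proof.
unfold minus. rewrite -plus_assoc. apply f_equal.
now rewrite plus_assoc plus_opp_l plus_zero_l.
Qed.

Lemma minus_plus_cancel {G : AbelianGroup} (x y z : G) :
  minus (plus x z) (plus y z) = minus x y.
Proof.
unfold minus. rewrite opp_plus -plus_assoc (plus_comm (opp y)) (plus_assoc z) plus_opp_r.
now rewrite plus_zero_l.
Qed.

Lemma minus_plus_swap {G : AbelianGroup} (a b c d : G) :
  minus (minus a b) (minus c d) = minus (minus a c) (minus b d).
Proof.
unfold minus. rewrite !opp_plus !opp_opp -!plus_assoc. apply f_equal.
rewrite !plus_assoc. apply f_equal2; [|easy]. apply plus_comm.
Qed.

Lemma minus_zero_eq {G : AbelianGroup} (x y : G) : minus x y = zero -> x = y.
Proof. intros H. apply plus_reg_r with (opp y). now rewrite plus_opp_r. Qed.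

Lemma filterlim_norm_intro {U : Type} {K : AbsRing} {V : NormedModule K}
  (F : (U -> Prop) -> Prop) (HF : Filter F) (f : U -> V) (l : V) :
  (forall eps, 0 < eps -> F (fun u => norm (minus (f u) l) < eps)) ->
  filterlim f F (locally l).
Proof.
intros H. apply filterlim_locally_ball_norm. intros eps.
exact (H eps (cond_pos eps)).
Qed.

Lemma filterlim_norm_elim {U : Type} {K : AbsRing} {V : NormedModule K}
  (F : (U -> Prop) -> Prop) (HF : Filter F) (f : U -> V) (l : V) :
  filterlim f F (locally l) ->
  forall eps, 0 < eps -> F (fun u => norm (minus (f u) l) < eps).
Proof.
intros H eps Heps.
exact (proj1 (filterlim_locally_ball_norm f l) H (mkposreal eps Heps)).
Qed.

Lemma norm_minus_sym {K : AbsRing} {V : NormedModule K} (x y : V) :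
  norm (minus x y) = norm (minus y x).
Proof. now rewrite -norm_opp opp_minus. Qed.

Lemma norm_minus_triangle {K : AbsRing} {V : NormedModule K} (x y z : V) :
  norm (minus x z) <= norm (minus x y) + norm (minus y z).
Proof. rewrite (minus_minus_plus x y z). apply: norm_triangle. Qed.

Lemma norm_le_plus_minus {K : AbsRing} {V : NormedModule K} (x y : V) :
  norm x <= norm y + norm (minus x y).
Proof.
replace x with (plus y (minus x y)) at 1.
- apply norm_triangle.
- unfold minus. rewrite plus_comm. rewrite -plus_assoc. rewrite plus_opp_l. apply plus_zero_r.
Qed.

(** The axiom [norm_scal] gives one inequality; the other is the same axiom applied to [/ k] and
    [scal k x]. *)
Lemma norm_scal_R {V : NormedModule R_AbsRing} (k : R) (x : V) :
  norm (scal k x) = Rabs k * norm x.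
Proof.
apply Rle_antisym; [exact (norm_scal k x)|].
destruct (Req_dec k 0) as [->|Hk].
- rewrite Rabs_R0 Rmult_0_l. apply norm_ge_0.
- pose proof (norm_scal (/ k) (scal k x)) as H.
  rewrite scal_assoc in H. change (mult (/ k) k) with (/ k * k) in H.
  rewrite -> Rinv_l in H by easy. change 1 with (one : R_AbsRing) in H.
  rewrite scal_one in H. change (abs (/ k)) with (Rabs (/ k)) in H.
  rewrite Rabs_inv in H. pose proof (Rabs_pos_lt k Hk).
  apply Rmult_le_compat_l with (r := Rabs k) in H; [|lra].
  rewrite -Rmult_assoc in H. rewrite -> Rinv_r in H by lra. lra.
Qed.

(** Since [2 y] is the difference of [x + y] and [x - y], the two norms cannot both be below
    [norm y]. This finds, near any centre, a point with a large image. *)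
Lemma norm_half_sum {V : NormedModule R_AbsRing} (x y : V) :
  norm y <= norm (plus x y) \/ norm y <= norm (minus x y).
Proof.
destruct (Rle_dec (norm y) (norm (plus x y))) as [H|H]; [now left|right].
assert (E : minus (plus x y) (minus x y) = scal 2 y).
{ unfold minus. rewrite opp_plus opp_opp.
  replace 2 with (plus (one : R_AbsRing) (one : R_AbsRing)) by (cbv; lra).
  rewrite scal_distr_r !scal_one.
  rewrite (plus_comm x y) -plus_assoc (plus_assoc x (opp x) y) plus_opp_r.
  now rewrite plus_zero_l. }
assert (H2 : norm (scal 2 y) = 2 * norm y).
{ rewrite norm_scal_R. rewrite -> Rabs_pos_eq by lra. lra. }
pose proof (norm_triangle (plus x y) (opp (minus x y))) as H3.
rewrite norm_opp in H3. change (plus (plus x y) (opp (minus x y)))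
  with (minus (plus x y) (minus x y)) in H3. rewrite E H2 in H3. lra.
Qed.

(** The third hypothesis places each closed ball inside the previous one; with radii tending to 0
    the centres are Cauchy, and their limit lies in all the balls. *)
Lemma nested_balls {E : CompleteNormedModule R_AbsRing} (c : nat -> E) (r : nat -> R) :
  (forall n, 0 < r n) ->
  (forall n, r (S n) <= r n / 2) ->
  (forall n, norm (minus (c (S n)) (c n)) + r (S n) <= r n) ->
  exists y, forall n, norm (minus y (c n)) <= r n.
Proof.
intros Hr Hhalf Hnest.
assert (Hmono : forall n k, norm (minus (c (n + k)%nat) (c n)) + r (n + k)%nat <= r n).
{ intros n k. induction k as [|k IH].
  - rewrite Nat.add_0_r minus_eq_zero norm_zero. lra.
  - rewrite Nat.add_succ_r. pose proof (Hnest (n + k)%nat).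
    have : norm (minus (c (S (n + k))) (c n)) <= norm (minus (c (S (n + k))) (c (n + k)%nat))
      + norm (minus (c (n + k)%nat) (c n)) by apply: norm_minus_triangle.
    lra. }
(* Halving gives in particular the rate [1 / (n + 1)], which the Archimedean property can compare
   with any [eps]. *)
assert (Hto0 : forall n, r n <= r 0%nat / INR (S n)).
{ intros n. induction n as [|n IH].
  - simpl. lra.
  - eapply Rle_trans; [apply Hhalf|].
    eapply Rle_trans; [apply Rmult_le_compat_r; [lra|apply IH]|].
    unfold Rdiv. rewrite Rmult_assoc. apply Rmult_le_compat_l; [left; apply Hr|].
    rewrite -Rinv_mult. pose proof (pos_INR n). rewrite !S_INR.
    apply Rinv_le_contravar; lra. }
destruct (proj1 (filterlim_locally_cauchy (F := eventually) c)) as [y Hy].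
- intros eps.
  destruct (INR_unbounded (2 * r 0%nat / eps)) as [n Hn'].
  assert (Hn : 2 * r n < eps).
  { pose proof (Hr 0%nat) as H0. pose proof (cond_pos eps) as He.
    assert (Hq : 0 < 2 * r 0%nat / eps) by (apply Rdiv_lt_0_compat; lra).
    assert (Hn : 2 * r 0%nat / eps < INR (S n)) by (rewrite S_INR; lra).
    apply Rle_lt_trans with (2 * (r 0%nat / INR (S n))).
    - pose proof (Hto0 n). lra.
    - assert (0 < INR (S n)) by lra.
      apply Rmult_lt_reg_r with (INR (S n)); [lra|].
      apply Rmult_lt_compat_r with (r := eps) in Hn; [|lra].
      field_simplify in Hn; [|lra]. field_simplify; lra. }
  exists (fun m => (n <= m)%nat). split.
  + exists n. auto.
  + intros u v Hu Hv. apply: norm_compat1.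
    pose proof (Hmono n (u - n)%nat) as Mu. pose proof (Hmono n (v - n)%nat) as Mv.
    replace (n + (u - n))%nat with u in Mu by lia.
    replace (n + (v - n))%nat with v in Mv by lia.
    pose proof (Hr u); pose proof (Hr v).
    apply: Rle_lt_trans; [exact: (norm_minus_triangle _ (c n))|].
    have : norm (minus (c n) (c u)) = norm (minus (c u) (c n)) by apply: norm_minus_sym.
    move=> Hsym. change (norm (minus (c v) (c n)) + norm (minus (c n) (c u)) < eps).
    lra.
- exists y. intros n.
  (* If [y] were outside the n-th ball, a late centre closer to [y] than the gap would be outside as
     well. *)
  apply Rnot_lt_le. intros Hlt.
  destruct (filterlim_norm_elim _ _ _ _ Hy (norm (minus y (c n)) - r n)) as [N HN]; [lra|].
  specialize (HN (n + N)%nat ltac:(lia)).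
  pose proof (Hmono n N). pose proof (Hr (n + N)%nat).
  have : norm (minus y (c n)) <= norm (minus y (c (n + N)%nat))
    + norm (minus (c (n + N)%nat) (c n)) by apply: norm_minus_triangle.
  have : norm (minus y (c (n + N)%nat)) = norm (minus (c (n + N)%nat) y)
    by apply: norm_minus_sym.
  change (norm (minus (c (n + N)%nat) y) < norm (minus y (c n)) - r n) in HN.
  lra.
Qed.

(* If the family is not uniformly bounded, every ball contains a smaller one on
   which some member exceeds [n]; a common point of a nested sequence of such
   balls contradicts pointwise boundedness. *)
Lemma uniform_boundedness {I : Type} {E : CompleteNormedModule R_AbsRing}
  {F : NormedModule R_AbsRing} (L : I -> E -> F) :
  (forall i, is_linear (L i)) ->
  (forall x, exists M, forall i, norm (L i x) <= M) ->
  exists M, forall i x, norm (L i x) <= M * norm x.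
Proof.
intros HL Hpt. apply NNPP. intros Hn.
assert (Hstep : forall (n : nat) (b : E * posreal), exists b' : E * posreal,
  snd b' <= snd b / 2 /\
  norm (minus (fst b') (fst b)) + snd b' <= snd b /\
  exists i, forall y, norm (minus y (fst b')) <= snd b' -> INR n <= norm (L i y)).
{ intros n [x [r Hr]]. simpl.
  (* The factor is chosen so that [z], rescaled to norm [r / 2], has an image of norm at least
     [n + 1]. *)
  assert (exists i z, (INR n + 1) * 2 / r * norm z < norm (L i z)) as (i & z & Hz).
  { apply NNPP. intros H. apply Hn. exists ((INR n + 1) * 2 / r). intros i z.
    apply Rnot_lt_le. intros Hz. apply H. now exists i, z. }
  assert (Hz0 : 0 < norm z).
  { destruct (Rle_lt_or_eq_dec 0 (norm z) (norm_ge_0 z)) as [|E0]; [easy|].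
    apply eq_sym, norm_eq_zero in E0. subst z.
    rewrite (linear_zero _ (HL i)) !norm_zero in Hz. lra. }
  set (y := scal (r / 2 / norm z) z).
  assert (Hc : 0 < r / 2 / norm z) by (apply Rdiv_lt_0_compat; lra).
  assert (Hy : norm y = r / 2).
  { unfold y. rewrite norm_scal_R. rewrite -> Rabs_pos_eq by lra.
    field. lra. }
  assert (HLy : INR n + 1 <= norm (L i y)).
  { unfold y. rewrite (linear_scal _ (HL i)) norm_scal_R.
    rewrite -> Rabs_pos_eq by lra.
    apply Rmult_lt_compat_l with (r := r / 2 / norm z) in Hz; [|easy].
    replace (r / 2 / norm z * ((INR n + 1) * 2 / r * norm z)) with (INR n + 1) in Hz
      by (field; lra). lra. }
  assert (exists x', norm (minus x' x) = r / 2 /\ INR n + 1 <= norm (L i x')) as (x' & Hx' & HLx').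
  { destruct (norm_half_sum (L i x) (L i y)) as [H|H].
    - exists (plus x y). rewrite (linear_plus _ (HL i)). split; [|lra].
      rewrite -Hy. apply f_equal. unfold minus.
      now rewrite (plus_comm x y) -plus_assoc plus_opp_r plus_zero_r.
    - exists (minus x y). rewrite (linear_minus _ _ _ (HL i)). split; [|lra].
      rewrite -Hy -(norm_opp y). apply f_equal. unfold minus.
      now rewrite (plus_comm x (opp y)) -plus_assoc plus_opp_r plus_zero_r. }
  (* With [C] a bound for [L i], the radius [/ C] lets [L i] vary by at most 1 on the new ball, so
     [n] remains of the [n + 1] attained at its centre. The bound [r / 2] keeps the new ball inside
     the old one. *)
  destruct (linear_norm _ (HL i)) as (C & HC0 & HC).
  assert (Hr' : 0 < Rmin (r / 2) (/ C)).
  { apply Rmin_pos; [lra|]. now apply Rinv_0_lt_compat. }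
  exists (x', mkposreal _ Hr'). simpl.
  pose proof (Rmin_l (r / 2) (/ C)). pose proof (Rmin_r (r / 2) (/ C)).
  repeat split; [lra|lra|].
  exists i. intros w Hw.
  have H1 : norm (L i x') <= norm (L i w) + norm (L i (minus x' w)).
  { rewrite (linear_minus _ _ _ (HL i)). apply: norm_le_plus_minus. }
  assert (norm (L i (minus x' w)) <= 1); [|lra].
  apply: (Rle_trans _ _ _ (HC _)).
  have Hs : norm (minus x' w) = norm (minus w x') by apply: norm_minus_sym.
  apply Rle_trans with (C * / C); [apply Rmult_le_compat_l; lra|].
  right; field; lra. }
set (next n b := proj1_sig (constructive_indefinite_description _ (Hstep n b))).
set (b := nat_rect (fun _ => (E * posreal)%type) (zero, mkposreal 1 Rlt_0_1) next).
assert (Hb : forall n, snd (b (S n)) <= snd (b n) / 2 /\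
  norm (minus (fst (b (S n))) (fst (b n))) + snd (b (S n)) <= snd (b n) /\
  exists i, forall y, norm (minus y (fst (b (S n)))) <= snd (b (S n)) -> INR n <= norm (L i y)).
{ intros n. exact (proj2_sig (constructive_indefinite_description _ (Hstep n (b n)))). }
destruct (nested_balls (fun n => fst (b n)) (fun n => pos (snd (b n)))) as [y Hy].
- intros n. apply cond_pos.
- apply Hb.
- apply Hb.
- destruct (Hpt y) as [M HM].
  destruct (INR_unbounded M) as [n Hn'].
  destruct (Hb n) as (_ & _ & i & Hi).
  specialize (Hi y (Hy (S n))). specialize (HM i). lra.
Qed.

(** * Right derivatives *)

(* The set of [s] with [norm (f r - f a) <= eps (r - a)] on all of [a, s] is
   closed by continuity and extends to the right, hence is all of [a, b]. *)
Lemma zero_right_derivative_const {V : NormedModule R_AbsRing} (f : R -> V) (a b : R) :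
  a <= b ->
  (forall s, a <= s <= b ->
    filterlim f (within (fun r => a <= r <= b) (locally s)) (locally (f s))) ->
  (forall s, a <= s < b ->
    filterlim (fun h => scal (/ h) (minus (f (s + h)) (f s))) (at_right 0)
      (locally (zero : V))) ->
  f b = f a.
Proof.
intros Hab Hcont Hder.
assert (Hle : forall eps, 0 < eps -> norm (minus (f b) (f a)) <= eps * (b - a)).
{ intros eps Heps.
  set (G := fun r => norm (minus (f r) (f a)) <= eps * (r - a)).
  set (P := fun s => a <= s <= b /\ forall r, a <= r <= s -> G r).
  assert (Pa : P a).
  { split; [lra|]. intros r Hr. replace r with a by lra. unfold G.
    rewrite minus_eq_zero norm_zero. lra. }
  destruct (completeness P) as [c [Hub Hlub]].
  { exists b. now intros s [Hs _]. }
  { now exists a. }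
  assert (Hac : a <= c) by now apply Hub.
  assert (Hcb : c <= b) by (apply Hlub; now intros s [Hs _]).
  assert (Hbelow : forall r, a <= r < c -> G r).
  { intros r Hr. apply NNPP. intros HG. apply (Rlt_not_le c r); [easy|].
    apply Hlub. intros s [Hs HsG]. apply Rnot_lt_le. intros Hrs.
    apply HG, HsG. lra. }
  (* Left continuity of [f] at [c] carries the bound from points [r] just below [c] to [c] itself,
     up to an arbitrary [eta]. *)
  assert (Gc : G c).
  { destruct (Rle_lt_or_eq_dec a c Hac) as [Hlt|<-]; [|apply Pa; lra].
    apply le_epsilon. intros eta Heta.
    destruct (filterlim_norm_elim _ _ _ _ (Hcont c (conj Hac Hcb)) eta Heta) as [d Hd].
    pose proof (cond_pos d) as Hd0.
    set (r := Rmax a (c - d / 2)).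
    assert (Hr : a <= r < c /\ c - d / 2 <= r).
    { unfold r. split; [split|]; [apply Rmax_l|apply Rmax_lub_lt; lra|apply Rmax_r]. }
    assert (Hball : ball c d r).
    { change (Rabs (r - c) < d). rewrite -> Rabs_left by lra. lra. }
    specialize (Hd r Hball ltac:(lra)). pose proof (Hbelow r ltac:(lra)) as HG.
    unfold G in HG.
    pose proof (norm_minus_triangle (f c) (f r) (f a)) as H1.
    rewrite (norm_minus_sym (f c) (f r)) in H1.
    assert (eps * (r - a) <= eps * (c - a)) by (apply Rmult_le_compat_l; lra). lra. }
  assert (Pc : P c).
  { split; [lra|]. intros r Hr. destruct (Rle_lt_or_eq_dec r c ltac:(lra)) as [H| ->]; [|easy].
    apply Hbelow. lra. }
  destruct (Rle_lt_or_eq_dec c b Hcb) as [Hlt| ->]; [exfalso|easy].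
  (* If [c < b], the zero right derivative at [c] extends the bound to [c + e], against [c] being
     the supremum. *)
  destruct (filterlim_norm_elim _ _ _ _ (Hder c (conj Hac Hlt)) eps Heps) as [d Hd].
  pose proof (cond_pos d) as Hd0.
  set (e := Rmin (d / 2) (b - c)).
  assert (He : 0 < e) by (apply Rmin_pos; lra).
  assert (He1 : e <= d / 2) by apply Rmin_l.
  assert (He2 : e <= b - c) by apply Rmin_r.
  assert (Pce : P (c + e)); [|specialize (Hub _ Pce); lra].
  split; [lra|]. intros r Hr.
  destruct (Rle_lt_dec r c) as [Hrc|Hrc]; [apply Pc; lra|].
  set (h := r - c). assert (Hh : 0 < h <= e) by (unfold h; lra).
  assert (Hball : ball 0 d h).
  { change (Rabs (h - 0) < d). rewrite Rminus_0_r. rewrite -> Rabs_pos_eq by lra. lra. }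
  specialize (Hd h Hball ltac:(lra)).
  replace (c + h) with r in Hd by (unfold h; ring).
  rewrite minus_zero_r norm_scal_R in Hd.
  rewrite -> Rabs_pos_eq in Hd by (left; apply Rinv_0_lt_compat; lra).
  assert (Hn : norm (minus (f r) (f c)) <= eps * h).
  { apply Rmult_lt_compat_l with (r := h) in Hd; [|lra].
    rewrite -Rmult_assoc in Hd. rewrite -> Rinv_r in Hd by lra. lra. }
  pose proof (norm_minus_triangle (f r) (f c) (f a)). unfold G in *.
  replace (eps * (r - a)) with (eps * h + eps * (c - a)) by (unfold h; ring). lra. }
apply NNPP. intros Hne. pose proof (norm_minus_gt_0 _ _ Hne) as Hpos.
(* This [eps] bounds the norm by at most half of itself; the [+ 1] keeps the denominator positive
   when [a = b]. *)
pose proof (Hle (norm (minus (f b) (f a)) / (2 * (b - a + 1)))) as H.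
assert (Hb : 0 < b - a + 1) by lra.
specialize (H ltac:(apply Rdiv_lt_0_compat; lra)).
assert ((b - a) / (b - a + 1) <= 1).
{ apply Rmult_le_reg_r with (b - a + 1); [lra|]. field_simplify; lra. }
replace (norm (minus (f b) (f a)) / (2 * (b - a + 1)) * (b - a))
  with (norm (minus (f b) (f a)) / 2 * ((b - a) / (b - a + 1))) in H by (field; lra).
assert (norm (minus (f b) (f a)) / 2 * ((b - a) / (b - a + 1))
  <= norm (minus (f b) (f a)) / 2 * 1) by (apply Rmult_le_compat_l; lra). lra.
Qed.

Section Derivatives.
Variable V : NormedModule R_AbsRing.

Lemma is_derive_right_quotient (f : R -> V) (x : R) (l : V) :
  is_derive f x l ->
  filterlim (fun h => scal (/ h) (minus (f (x + h)) (f x))) (at_right 0) (locally l).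
Proof.
intros [_ Hd]. apply filterlim_norm_intro; [apply _|]. intros eps Heps.
(* The derivative supplies a non-strict bound; taking it for [eps / 2] makes it strict. *)
assert (He2 : 0 < eps / 2) by lra.
destruct (Hd x (fun P H => H) (mkposreal _ He2)) as [d Hd'].
exists d. intros h Hh Hh0.
assert (Hball : ball x d (x + h)).
{ change (Rabs (h - 0) < d) in Hh. change (Rabs (x + h - x) < d).
  now replace (x + h - x) with (h - 0) by ring. }
specialize (Hd' _ Hball). simpl in Hd'.
assert (Em : minus (x + h : R_AbsRing) x = h) by (change (x + h + - x = h); ring).
rewrite Em in Hd'.
change (norm h) with (Rabs h) in Hd'. rewrite -> Rabs_pos_eq in Hd' by lra.
have -> : minus (scal (/ h) (minus (f (x + h)) (f x)) : V) l
  = scal (/ h) (minus (minus (f (x + h)) (f x)) (scal h l)).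
{ rewrite [RHS]scal_minus_distr_l (scal_assoc (/ h) h l).
  rewrite -> Rinv_l by lra. now rewrite (scal_one (K := R_AbsRing) l). }
rewrite norm_scal_R. rewrite -> Rabs_pos_eq by (left; apply Rinv_0_lt_compat; lra).
apply Rmult_lt_reg_l with h; [lra|]. rewrite -Rmult_assoc.
rewrite -> Rinv_r by lra.
change (norm (minus (minus (f (x + h)) (f x)) (scal h l)) <= eps / 2 * h) in Hd'.
assert (0 < h * eps) by (apply Rmult_lt_0_compat; lra). lra.
Qed.

Lemma is_derive_vector_unique (f : R -> V) (x : R) (l m : V) :
  is_derive f x l -> is_derive f x m -> l = m.
Proof.
intros Hl Hm. eapply (filterlim_locally_unique (F := at_right 0));
  apply is_derive_right_quotient; eassumption.
Qed.

Lemma is_derive_scal_mult (f : R -> R) (g : R -> V) (x l : R) (m : V) :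
  is_derive f x l -> is_derive g x m ->
  is_derive (fun s => scal (f s) (g s)) x (plus (scal l (g x)) (scal (f x) m)).
Proof.
intros Hf Hg. eapply filterdiff_ext_lin.
- apply: (filterdiff_scal_fct x f g _ _ _ Hf Hg). exact Rmult_comm.
- intros y. simpl. rewrite scal_distr_l. apply f_equal2.
  + now rewrite scal_assoc.
  + rewrite !scal_assoc. apply f_equal2; [apply Rmult_comm|easy].
Qed.

Lemma is_derive_linear {W : NormedModule R_AbsRing} (L : V -> W) (f : R -> V) (x : R) (l : V) :
  is_linear L -> is_derive f x l -> is_derive (fun s => L (f s)) x (L l).
Proof.
intros HL Hf. eapply filterdiff_ext_lin.
- apply: (filterdiff_comp _ _ _ _ Hf). apply: filterdiff_linear. exact HL.
- intros y. simpl. apply (linear_scal _ HL).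
Qed.

Lemma is_derive_shift (f : R -> V) (c x : R) (l : V) :
  is_derive f (x - c) l -> is_derive (fun s => f (s - c)) x l.
Proof.
intros Hf. rewrite -(scal_one (K := R_AbsRing) l).
apply: is_derive_comp; [exact Hf|]. auto_derive; [easy|]. unfold one; simpl; ring.
Qed.

End Derivatives.

(** * Delayed equations driven by a real group *)

Lemma plus_plus_rotate {G : AbelianGroup} (p x y z : G) :
  plus (plus p x) (plus y z) = plus (plus p z) (plus x y).
Proof.
rewrite -!plus_assoc. apply f_equal. now rewrite [RHS]plus_comm -plus_assoc.
Qed.

Lemma filterlim_plus_fun {U : Type} {K : AbsRing} {V : NormedModule K}
  {F : (U -> Prop) -> Prop} {FF : Filter F} (f g : U -> V) (l m : V) :
  filterlim f F (locally l) -> filterlim g F (locally m) ->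
  filterlim (fun u => plus (f u) (g u)) F (locally (plus l m)).
Proof. intros Hf Hg. exact (filterlim_comp_2 _ _ plus Hf Hg (filterlim_plus l m)). Qed.

Lemma filterlim_minus_fun {U : Type} {K : AbsRing} {V : NormedModule K}
  {F : (U -> Prop) -> Prop} {FF : Filter F} (f g : U -> V) (l m : V) :
  filterlim f F (locally l) -> filterlim g F (locally m) ->
  filterlim (fun u => minus (f u) (g u)) F (locally (minus l m)).
Proof.
intros Hf Hg. apply: (filterlim_plus_fun _ _ _ _ Hf).
exact (filterlim_comp _ _ _ _ _ _ _ _ Hg (filterlim_opp m)).
Qed.

Lemma filterlim_within_ext {U V : Type} {F : (U -> Prop) -> Prop} {G : (V -> Prop) -> Prop}
  {FF : Filter F} (P : U -> Prop) (f g : U -> V) :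
  (forall u, P u -> f u = g u) ->
  filterlim f (within P F) G -> filterlim g (within P F) G.
Proof.
intros H. apply filterlim_ext_loc. unfold within. now apply filter_forall.
Qed.

Lemma indicator_ge_1 (t a : R) : a <= t -> indicator_ge t a = 1.
Proof. intros H. unfold indicator_ge. now destruct (Rle_dec a t). Qed.

Lemma indicator_ge_0 (t a : R) : t < a -> indicator_ge t a = 0.
Proof. intros H. unfold indicator_ge. destruct (Rle_dec a t); [lra|easy]. Qed.

Lemma sum_n_stable {G : AbelianMonoid} (u : nat -> G) (M N : nat) :
  (M <= N)%nat -> (forall n, (M < n)%nat -> u n = zero) -> sum_n u N = sum_n u M.
Proof.
intros HMN Hu. induction HMN as [|N HMN IH]; [easy|].
rewrite sum_Sn IH. rewrite -> Hu by lia. apply plus_zero_r.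
Qed.

Section LinearMaps.
Context {K : AbsRing} {U V : NormedModule K}.

Lemma linear_sum_n (L : U -> V) (HL : is_linear L) (u : nat -> U) (N : nat) :
  L (sum_n u N) = sum_n (fun n => L (u n)) N.
Proof.
induction N as [|N IH]; [now rewrite !sum_O|].
now rewrite !sum_Sn (linear_plus _ HL) IH.
Qed.

(** Stated over a general [K] to serve both real and complex scalars. Multiplication by a constant
    is shown linear using commuting scalars, which an [AbsRing] does not guarantee. *)
Lemma is_linear_sum_n (c : nat -> K) (L : nat -> U -> V) (N : nat) :
  (forall a b : K, mult a b = mult b a) -> (forall n, is_linear (L n)) ->
  is_linear (fun x => sum_n (fun n => scal (c n) (L n x)) N).
Proof.
intros Hcomm HL.
assert (Hn : forall n, is_linear (fun x => scal (c n) (L n x))).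
{ intros n. apply: (is_linear_comp (L n)); [easy|]. now apply is_linear_scal_r. }
induction N as [|N IH].
- eapply is_linear_ext; [|exact (Hn 0%nat)]. intros x. now rewrite sum_O.
- eapply is_linear_ext;
    [|exact: (is_linear_comp _ _ (is_linear_prod _ _ IH (Hn (S N))) is_linear_plus)].
  intros x. simpl. now rewrite sum_Sn.
Qed.

Lemma is_linear_iter (L : U -> U) (n : nat) : is_linear L -> is_linear (Nat.iter n L).
Proof.
intros HL. induction n as [|n IH]; [apply is_linear_id|].
exact (is_linear_comp _ _ IH HL).
Qed.

End LinearMaps.

Lemma is_derive_pow_fact (m : nat) (a t : R) :
  is_derive (fun s => (s - a) ^ S m / INR (fact (S m))) t ((t - a) ^ m / INR (fact m)).
Proof.
assert (H1 : is_derive (fun s => s - a) t 1) by (auto_derive; [easy|ring]).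
apply (is_derive_pow _ (S m)) in H1.
apply (is_derive_scal_l _ _ _ (/ INR (fact (S m)) : R_NormedModule)) in H1.
replace ((t - a) ^ m / INR (fact m))
  with (INR (S m) * 1 * (t - a) ^ m * / INR (fact (S m))); [exact H1|].
rewrite fact_simpl mult_INR. field. split; [apply INR_fact_neq_0|now apply not_0_INR].
Qed.

(** * Local boundedness and joint continuity of the group *)

Section StronglyContinuousGroup.
Variable E : CompleteNormedModule R_AbsRing.
Variable T : R -> E -> E.
Hypothesis T_linear : forall t, is_linear (T t).
Hypothesis T_0 : forall x, T 0 x = x.
Hypothesis T_plus : forall s t x, T (s + t) x = T s (T t x).
Hypothesis T_continuous : forall x t, continuous (fun s => T s x) t.

(** Each orbit is continuous, hence bounded on [[a, b]]; uniform boundedness, for the family indexed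
    by the points of [[a, b]], makes the bound independent of the vector. *)
Lemma group_locally_bounded (a b : R) :
  exists M, forall s, a <= s <= b -> forall x, norm (T s x) <= M * norm x.
Proof.
destruct (uniform_boundedness (fun s : {s | a <= s <= b} => T (proj1_sig s))) as [M HM].
- intros s. apply T_linear.
- intros x. destruct (bounded_continuity (fun s => T s x) a b) as [M HM].
  + intros s _. apply T_continuous.
  + exists M. intros [s Hs]. left. now apply HM.
- exists M. intros s Hs x. exact (HM (exist _ s Hs) x).
Qed.

(** Split [T u y - T u0 y0] as [T u (y - y0)] plus [T u y0 - T u0 y0]: the local bound controls the
    first part, strong continuity the second. *)
Lemma group_filterlim {U : Type} (F : (U -> Prop) -> Prop) {HF : Filter F}
  (u : U -> R) (y : U -> E) (u0 : R) (y0 : E) :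
  filterlim u F (locally u0) -> filterlim y F (locally y0) ->
  filterlim (fun a => T (u a) (y a)) F (locally (T u0 y0)).
Proof.
intros Hu Hy. apply: filterlim_norm_intro => eps Heps.
destruct (group_locally_bounded (u0 - 1) (u0 + 1)) as [M HM].
(* [M] may be 0 or negative; [M'] is a positive bound that can be divided by. *)
set (M' := Rmax M 0 + 1).
assert (HM'0 : 0 < M') by (unfold M'; pose proof (Rmax_r M 0); lra).
assert (HM' : M <= M') by (unfold M'; pose proof (Rmax_l M 0); lra).
assert (Hy' := filterlim_norm_elim (V:=E) _ _ _ _ Hy (eps / 2 / M')
  ltac:(apply Rdiv_lt_0_compat; lra)).
assert (Hu1 := proj1 (filterlim_locally u u0) Hu (mkposreal 1 Rlt_0_1)).
assert (Hu2 := filterlim_norm_elim _ _ _ _ (filterlim_comp _ _ _ _ _ _ _ _ Hu (T_continuous y0 u0))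
  (eps / 2) ltac:(lra)).
generalize (filter_and _ _ Hy' (filter_and _ _ Hu1 Hu2)). apply filter_imp.
intros a (Ha & Hb & Hc).
change (Rabs (u a - u0) < 1) in Hb. apply Rabs_lt_between in Hb.
have H3 : norm (minus (T (u a) (y a)) (T u0 y0))
  <= norm (T (u a) (minus (y a) y0)) + norm (minus (T (u a) y0) (T u0 y0)).
{ rewrite (linear_minus _ _ _ (T_linear (u a))). apply: norm_minus_triangle. }
change (norm (minus (T (u a) y0) (T u0 y0)) < eps / 2) in Hc.
apply: (Rle_lt_trans _ _ _ H3).
suff : norm (T (u a) (minus (y a) y0)) <= eps / 2 by lra.
apply: (Rle_trans _ _ _ (HM (u a) ltac:(lra) _)).
apply Rle_trans with (M' * (eps / 2 / M')); [|right; field; lra].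
apply Rle_trans with (M' * norm (minus (y a) y0)).
- apply Rmult_le_compat_r; [apply norm_ge_0|easy].
- apply Rmult_le_compat_l; [lra|]. left. exact Ha.
Qed.

(** * The generator, its domain and density *)

Variable D : E -> Prop.
Variable A : E -> E.
Hypothesis D_iff : forall x, D x <-> exists y, is_derive (fun t => T t x) 0 y.
Hypothesis A_derive : forall x, D x -> is_derive (fun t => T t x) 0 (A x).

Lemma generator_intro (x y : E) :
  is_derive (fun t => T t x) 0 y -> D x /\ A x = y.
Proof.
intros H. assert (HD : D x) by (apply D_iff; now exists y). split; [easy|].
eapply is_derive_vector_unique; [now apply A_derive|exact H].
Qed.

(** Such an [L] maps the orbit of [x] to the orbit of [L x], so differentiability at 0 passes
    through [L]. Applied later to the solution operator, it shows that the solution stays in [D]. *)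
Lemma generator_commute (L : E -> E) (x : E) :
  is_linear L -> (forall u y, T u (L y) = L (T u y)) -> D x ->
  D (L x) /\ A (L x) = L (A x).
Proof.
intros HL Hc Hx. apply generator_intro.
apply is_derive_ext with (fun t => L (T t x)); [intros t; now rewrite Hc|].
apply is_derive_linear; [easy|]. now apply A_derive.
Qed.

Lemma generator_minus (x y : E) :
  D x -> D y -> D (minus x y) /\ A (minus x y) = minus (A x) (A y).
Proof.
intros Hx Hy. apply generator_intro.
apply is_derive_ext with (fun t => minus (T t x) (T t y)).
- intros t. now rewrite (linear_minus _ _ _ (T_linear t)).
- apply: is_derive_minus; now apply A_derive.
Qed.

Lemma group_comm (s t : R) (x : E) : T s (T t x) = T t (T s x).
Proof. now rewrite -!T_plus Rplus_comm. Qed.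

Lemma group_derive (x : E) (t : R) : D x -> is_derive (fun s => T s x) t (T t (A x)).
Proof.
intros Hx. apply is_derive_ext with (fun s => T t (T (s - t) x)).
- intros s. now rewrite -T_plus Rplus_minus.
- apply is_derive_linear; [apply T_linear|].
  apply: (is_derive_shift _ (fun s => T s x) t).
  replace (t - t) with 0 by ring. now apply A_derive.
Qed.

Lemma orbit_integral (x : E) (a b : R) :
  is_RInt (fun s => T s x) a b (RInt (fun s => T s x) a b).
Proof.
apply RInt_correct, ex_RInt_continuous. intros z _. apply T_continuous.
Qed.

Lemma orbit_integral_derive (x : E) (t : R) :
  is_derive (fun h => RInt (fun s => T s x) 0 h) t (T t x).
Proof.
apply: (is_derive_RInt (fun s => T s x) _ 0); [|apply T_continuous].
apply filter_forall. intros h. apply orbit_integral.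
Qed.

(** Both sides are the integral of [T (s + u) x] over [[0, h]], computed from two antiderivatives:
    [T u] applied to the orbit integral, and the shifted orbit integral. *)
Lemma group_orbit_integral (x : E) (u h : R) :
  T u (RInt (fun s => T s x) 0 h) =
  minus (RInt (fun s => T s x) 0 (h + u)) (RInt (fun s => T s x) 0 u).
Proof.
set (G := fun h => RInt (fun s => T s x) 0 h).
assert (Hc : forall s, continuous (fun s => T (s + u) x) s).
{ intros s. apply: (continuous_comp (fun s => s + u) (fun s => T s x)); [|apply T_continuous].
  apply: continuous_plus; [apply continuous_id|apply continuous_const]. }
assert (H1 : is_RInt (fun s => T (s + u) x) 0 h (minus (T u (G h)) (T u (G 0)))).
{ apply: (is_RInt_derive (fun s => T u (G s))); [|intros; apply Hc].
  intros s _. rewrite Rplus_comm T_plus.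
  apply is_derive_linear; [apply T_linear|apply orbit_integral_derive]. }
assert (H2 : is_RInt (fun s => T (s + u) x) 0 h (minus (G (h + u)) (G (0 + u)))).
{ apply: (is_RInt_derive (fun s => G (s + u))); [|intros; apply Hc].
  intros s _. apply is_derive_ext with (fun s => G (s - - u)).
  - intros r. apply f_equal. ring.
  - apply: is_derive_shift. replace (s + u) with (s - - u) by ring.
    apply orbit_integral_derive. }
assert (G0 : G 0 = zero) by apply RInt_point.
rewrite G0 (linear_zero _ (T_linear u)) minus_zero_r in H1.
rewrite Rplus_0_l in H2. change (T u (G h) = minus (G (h + u)) (G u)).
now rewrite -(is_RInt_unique _ _ _ _ H1) -(is_RInt_unique _ _ _ _ H2).
Qed.

(** By the preceding formula, [T u] moves [u] into the upper limits of orbit integrals, which are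
    differentiable in those limits. *)
Lemma orbit_integral_domain (x : E) (h : R) : D (RInt (fun s => T s x) 0 h).
Proof.
apply D_iff. exists (minus (T h x) (T 0 x)).
eapply is_derive_ext; [intros u; symmetry; apply group_orbit_integral|].
apply: is_derive_minus; [|apply orbit_integral_derive].
apply is_derive_ext with (fun u => RInt (fun s => T s x) 0 (u - - h)).
- intros u. apply f_equal. ring.
- apply: (is_derive_shift _ (fun r => RInt (fun s => T s x) 0 r)).
  replace (0 - - h) with h by ring. apply orbit_integral_derive.
Qed.

Lemma generator_scal (k : R) (x : E) : D x -> D (scal k x).
Proof.
intros Hx. apply (generator_commute (fun y => scal k y)); [|  |easy].
- apply: is_linear_scal_r. exact Rmult_comm.
- intros u y. apply (linear_scal _ (T_linear u)).
Qed.

(* [D] is dense: [x] is the limit of [(1/h) int_0^h T s x ds] as [h -> 0+]. *)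
Lemma linear_eq_of_eq_domain (L1 L2 : E -> E) :
  is_linear L1 -> is_linear L2 -> (forall x, D x -> L1 x = L2 x) ->
  forall x, L1 x = L2 x.
Proof.
intros H1 H2 Heq x.
set (m := fun h => scal (/ h) (RInt (fun s => T s x) 0 h)).
assert (Hm : filterlim m (at_right 0) (locally x)).
{ rewrite -[X in locally X](T_0 x).
  eapply filterlim_ext; [|exact: (is_derive_right_quotient _ _ _ _ (orbit_integral_derive x 0))].
  intros h. simpl. rewrite RInt_point minus_zero_r Rplus_0_l. easy. }
apply (filterlim_locally_unique (K := R_AbsRing) (V := E) (F := at_right 0) (fun h => L1 (m h))).
- eapply filterlim_comp; [exact Hm|apply (linear_cont L1 x H1)].
- apply filterlim_ext with (fun h => L2 (m h)).
  + intros h. symmetry. apply Heq, generator_scal, orbit_integral_domain.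
  + eapply filterlim_comp; [exact Hm|apply (linear_cont L2 x H2)].
Qed.

(* [s |-> T (b - s) (v s)] has zero right derivative. *)
Lemma cauchy_problem_unique (v : R -> E) (a b : R) :
  a <= b ->
  (forall s, a <= s <= b ->
    filterlim v (within (fun r => a <= r <= b) (locally s)) (locally (v s))) ->
  (forall s, a <= s < b -> D (v s) /\
    filterlim (fun h => scal (/ h) (minus (v (s + h)) (v s))) (at_right 0)
      (locally (A (v s)))) ->
  v a = zero -> v b = zero.
Proof.
intros Hab Hcont Hder Ha.
assert (H : T (b - b) (v b) = T (b - a) (v a)).
{ apply (zero_right_derivative_const (fun s => T (b - s) (v s))); [easy| |].
  - intros s Hs. apply group_filterlim; [apply _| |now apply Hcont].
    eapply filterlim_filter_le_1; [apply filter_le_within|].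
    apply: (continuous_minus (fun _ => b) (fun r => r));
      [apply continuous_const|apply continuous_id].
  - intros s Hs. destruct (Hder s Hs) as [HD Hv].
    (* Product rule: the quotient is [T (b - s - h)] applied to the quotient of [v], plus the
       quotient of [T (b - s - h) (v s)] with [v s] frozen. The limits are [T (b - s) (A (v s))] and
       its opposite. *)
    assert (Hlim : filterlim (fun h => b - s - h) (at_right 0) (locally (b - s))).
    { eapply filterlim_filter_le_1; [apply filter_le_within|].
      assert (Hl : continuous (fun h => b - s - h) 0).
      { apply: (continuous_minus (fun _ => b - s) (fun r => r));
          [apply continuous_const|apply continuous_id]. }
      unfold continuous in Hl. rewrite Rminus_0_r in Hl. exact Hl. }
    assert (Hd : is_derive (fun h => T (b - s - h) (v s)) 0
      (scal (-1) (T (b - s) (A (v s))))).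
    { apply: (is_derive_comp (fun r => T r (v s)) (fun h => b - s - h)).
      - rewrite Rminus_0_r. now apply group_derive.
      - auto_derive; [easy|ring]. }
    apply is_derive_right_quotient in Hd.
    pose proof (group_filterlim _ _ _ _ _ Hlim Hv) as Hv'.
    pose proof (filterlim_plus_fun _ _ _ _ Hv' Hd) as Hs'.
    rewrite scal_opp_one plus_opp_r in Hs'.
    eapply filterlim_ext; [|exact Hs'].
    intros h. simpl.
    rewrite (linear_scal _ (T_linear _)) -scal_distr_l Rplus_0_l Rminus_0_r.
    apply f_equal. rewrite (linear_minus _ _ _ (T_linear _)).
    replace (b - (s + h)) with (b - s - h) by ring.
    symmetry. apply: minus_minus_plus. }
rewrite Ha (linear_zero _ (T_linear _)) in H.
now rewrite Rminus_diag T_0 in H.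
Qed.


(** * Uniqueness for the delayed equation *)

Variable tau : R.
Hypothesis tau_pos : 0 < tau.
Variable A1 : E -> E.
Hypothesis A1_linear : is_linear A1.
Hypothesis A1_commute : forall t x, T t (A1 x) = A1 (T t x).

(** What [is_fundamental_solution] asks of one trajectory [t |-> S t x] with [x] in [D], over real
    scalars, apart from its initial value. *)
Definition is_delay_orbit (u : R -> E) : Prop :=
  (forall t, - tau <= t < 0 -> u t = zero) /\
  (forall t, 0 <= t ->
    filterlim u (within (fun s => 0 <= s) (locally t)) (locally (u t))) /\
  (forall t, 0 <= t -> D (u t) /\
    filterlim (fun h => scal (/ h) (minus (u (t + h)) (u t))) (at_right 0)
      (locally (plus (A (u t)) (A1 (u (t - tau)))))).

(* Method of steps: if [v] vanishes up to [k tau], then on the next interval of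
   length [tau] its delayed term vanishes and [v' = A v]. *)
Lemma delay_orbit_unique (u1 u2 : R -> E) :
  is_delay_orbit u1 -> is_delay_orbit u2 -> u1 0 = u2 0 ->
  forall t, 0 <= t -> u1 t = u2 t.
Proof.
intros (Hh1 & Hc1 & He1) (Hh2 & Hc2 & He2) H0 t Ht.
set (v := fun s => minus (u1 s) (u2 s)).
assert (Hstep : forall k s, - tau <= s <= INR k * tau -> v s = zero).
{ intros k. induction k as [|k IH]; intros s Hs.
  - simpl in Hs. unfold v. destruct (Rle_lt_or_eq_dec s 0 ltac:(lra)) as [Hlt| ->].
    + rewrite -> Hh1, Hh2 by lra. apply: minus_eq_zero.
    + rewrite H0. apply: minus_eq_zero.
  - destruct (Rle_lt_dec s (INR k * tau)) as [Hle|Hlt]; [apply IH; lra|].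
    rewrite S_INR in Hs.
    assert (Hk : 0 <= INR k * tau) by (apply Rmult_le_pos; [apply pos_INR|lra]).
    apply (cauchy_problem_unique v (INR k * tau) s); [lra| | |apply IH; lra].
    + intros r Hr. apply: (filterlim_filter_le_1 (F := within (fun r => 0 <= r) (locally r))).
      * intros P HP. unfold within in *. eapply filter_imp; [|exact HP].
        intros y Hy Hy'. apply Hy. lra.
      * apply: (filterlim_minus_fun u1 u2); [apply Hc1|apply Hc2]; lra.
    + intros r Hr. destruct (He1 r ltac:(lra)) as [D1 L1].
      destruct (He2 r ltac:(lra)) as [D2 L2].
      destruct (generator_minus _ _ D1 D2) as [D12 A12]. split; [exact D12|].
      unfold v. rewrite A12.
      assert (Hd : minus (u1 (r - tau)) (u2 (r - tau)) = zero) by (apply IH; lra).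
      assert (Hd' : A1 (u1 (r - tau)) = A1 (u2 (r - tau))).
      { apply f_equal. exact (minus_zero_eq _ _ Hd). }
      rewrite Hd' in L1.
      pose proof (filterlim_minus_fun _ _ _ _ L1 L2) as L.
      replace (minus (A (u1 r)) (A (u2 r))) with
        (minus (plus (A (u1 r)) (A1 (u2 (r - tau)))) (plus (A (u2 r)) (A1 (u2 (r - tau))))).
      * eapply filterlim_ext; [|exact L]. intros h. simpl.
        rewrite -scal_minus_distr_l. apply f_equal. apply: minus_plus_swap.
      * apply: minus_plus_cancel. }
destruct (INR_archimed tau t tau_pos) as [k Hk].
exact (minus_zero_eq _ _ (Hstep k t ltac:(lra))).
Qed.

(** * The explicit solution of the delayed equation *)

Definition delay_op (n : nat) (t : R) (x : E) : E :=
  Nat.iter n A1 (T (t - INR n * tau) x).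

(** The solution agrees with this indicator-free sum on [[M tau, (M + 1) tau)]; for [x] in [D] the
    sum has a two-sided derivative at every [t]. *)
Definition delay_poly (M : nat) (t : R) (x : E) : E :=
  sum_n (fun n => scal ((t - INR n * tau) ^ n / INR (fact n)) (delay_op n t x)) M.

Definition delay_coef (n : nat) (t : R) : R :=
  (t - INR n * tau) ^ n / INR (fact n) * indicator_ge t (INR n * tau).

Definition delay_sum (M : nat) (t : R) (x : E) : E :=
  sum_n (fun n => scal (delay_coef n t) (delay_op n t x)) M.

(* The summands with [t < n tau] vanish, so any long enough partial sum would do. *)
Definition delay_solution (t : R) (x : E) : E :=
  delay_sum (Z.to_nat (up (t / tau))) t x.

Lemma iter_commute (n : nat) (t : R) (x : E) :
  T t (Nat.iter n A1 x) = Nat.iter n A1 (T t x).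
Proof. induction n as [|n IH]; simpl; [easy|]. now rewrite A1_commute IH. Qed.

Lemma delay_op_linear (n : nat) (t : R) : is_linear (delay_op n t).
Proof.
apply: (is_linear_comp (T (t - INR n * tau))); [easy|]. now apply is_linear_iter.
Qed.

Lemma delay_op_commute (n : nat) (t u : R) (x : E) :
  T u (delay_op n t x) = delay_op n t (T u x).
Proof. unfold delay_op. now rewrite iter_commute group_comm. Qed.

Lemma delay_op_succ (n : nat) (t : R) (x : E) :
  delay_op (S n) t x = A1 (delay_op n (t - tau) x).
Proof.
unfold delay_op. rewrite S_INR.
now replace (t - (INR n + 1) * tau) with (t - tau - INR n * tau) by ring.
Qed.

Lemma delay_op_derive (n : nat) (t : R) (x : E) :
  D x -> is_derive (fun s => delay_op n s x) t (delay_op n t (A x)).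
Proof.
intros Hx. apply: (is_derive_linear _ (Nat.iter n A1)); [now apply is_linear_iter|].
apply: (is_derive_shift _ (fun s => T s x) (INR n * tau)). now apply group_derive.
Qed.

(** Differentiating the weight of index [m + 1] gives the weight of index [m] at [t - tau], and
    [delay_op_succ] extracts [A1]. For [n = 0] the weight is constant, whence the [match]. *)
Lemma delay_term_derive (n : nat) (t : R) (x : E) :
  D x ->
  is_derive (fun s => scal ((s - INR n * tau) ^ n / INR (fact n)) (delay_op n s x)) t
    (plus
      match n with
      | O => zero
      | S m => A1 (scal ((t - tau - INR m * tau) ^ m / INR (fact m)) (delay_op m (t - tau) x))
      end
      (scal ((t - INR n * tau) ^ n / INR (fact n)) (delay_op n t (A x)))).
Proof.
intros Hx.
assert (Hc : is_derive (fun s => (s - INR n * tau) ^ n / INR (fact n)) t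
  match n with O => 0 | S m => (t - tau - INR m * tau) ^ m / INR (fact m) end).
{ destruct n as [|m].
  - apply is_derive_ext with (fun _ => 1 / INR (fact 0)); [easy|]. apply: is_derive_const.
  - replace (t - tau - INR m * tau) with (t - INR (S m) * tau) by (rewrite S_INR; ring).
    apply is_derive_pow_fact. }
pose proof (is_derive_scal_mult _ _ _ _ _ _ Hc (delay_op_derive n t x Hx)) as H.
destruct n as [|m]; simpl in H.
- rewrite (scal_zero_l (K := R_AbsRing)) in H. exact H.
- rewrite (linear_scal _ A1_linear) -delay_op_succ. exact H.
Qed.

(** Summed over the terms, the delayed parts form the sum with one index fewer at [t - tau], as
    expected since [t - tau] lies one step earlier. *)
Lemma delay_poly_derive (M : nat) (t : R) (x : E) :
  D x ->
  is_derive (fun s => delay_poly M s x) t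
    (plus (delay_poly M t (A x))
      match M with O => zero | S m => A1 (delay_poly m (t - tau) x) end).
Proof.
intros Hx. induction M as [|M IH].
- apply is_derive_ext with
    (fun s => scal ((s - INR 0 * tau) ^ 0 / INR (fact 0)) (delay_op 0 s x)).
  + intros s. unfold delay_poly. now rewrite sum_O.
  + unfold delay_poly. rewrite sum_O plus_comm. now apply delay_term_derive.
- apply is_derive_ext with (fun s => plus (delay_poly M s x)
    (scal ((s - INR (S M) * tau) ^ S M / INR (fact (S M))) (delay_op (S M) s x))).
  + intros s. unfold delay_poly. now rewrite sum_Sn.
  + pose proof (is_derive_plus _ _ _ _ _ IH (delay_term_derive (S M) t x Hx)) as H.
    assert (HZ : delay_poly (S M) t (A x) = plus (delay_poly M t (A x))
      (scal ((t - INR (S M) * tau) ^ S M / INR (fact (S M))) (delay_op (S M) t (A x)))).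
    { unfold delay_poly. now rewrite sum_Sn. }
    assert (HW : A1 (delay_poly M (t - tau) x) =
      plus match M with O => zero | S m => A1 (delay_poly m (t - tau) x) end
        (A1 (scal ((t - tau - INR M * tau) ^ M / INR (fact M)) (delay_op M (t - tau) x)))).
    { unfold delay_poly. destruct M as [|m].
      - now rewrite sum_O plus_zero_l.
      - now rewrite sum_Sn (linear_plus _ A1_linear). }
    rewrite HZ HW. refine (eq_ind _ (fun l => is_derive _ t l) H _ _). exact: plus_plus_rotate.
Qed.

Lemma delay_coef_0 (M n : nat) (t : R) :
  t < INR (S M) * tau -> (M < n)%nat -> delay_coef n t = 0.
Proof.
intros Ht Hn. unfold delay_coef. rewrite indicator_ge_0; [apply Rmult_0_r|].
eapply Rlt_le_trans; [exact Ht|]. apply Rmult_le_compat_r; [lra|]. apply le_INR. lia.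
Qed.

Lemma delay_sum_stable (M N : nat) (t : R) (x : E) :
  t < INR (S M) * tau -> (M <= N)%nat -> delay_sum N t x = delay_sum M t x.
Proof.
intros Ht HMN. apply sum_n_stable; [easy|]. intros n Hn.
rewrite -> (delay_coef_0 M) by easy. apply: scal_zero_l.
Qed.

Lemma delay_solution_sum (M : nat) (t : R) (x : E) :
  t < INR (S M) * tau -> delay_solution t x = delay_sum M t x.
Proof.
intros Ht. unfold delay_solution. set (N := Z.to_nat (up (t / tau))).
assert (HN : t < INR (S N) * tau).
{ destruct (archimed (t / tau)) as [Hup _].
  (* [Z.to_nat] sends negative integers to 0, so for general [t] only this inequality is available;
     its direction is the right one. *)
  assert (Hz : IZR (up (t / tau)) <= INR N).
  { unfold N. rewrite INR_IZR_INZ. apply IZR_le. lia. }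
  rewrite S_INR. replace t with (t / tau * tau) at 1 by (field; lra).
  apply Rmult_lt_compat_r; lra. }
destruct (Nat.le_ge_cases M N).
- now apply delay_sum_stable.
- symmetry. now apply delay_sum_stable.
Qed.

Lemma delay_sum_poly (M : nat) (t : R) (x : E) :
  INR M * tau <= t -> delay_sum M t x = delay_poly M t x.
Proof.
intros Ht. apply sum_n_ext_loc. intros n Hn. unfold delay_coef.
rewrite indicator_ge_1; [now rewrite Rmult_1_r|].
eapply Rle_trans; [|exact Ht]. apply Rmult_le_compat_r; [lra|]. now apply le_INR.
Qed.

Lemma delay_sum_linear (M : nat) (t : R) : is_linear (delay_sum M t).
Proof.
apply (is_linear_sum_n (K := R_AbsRing) (fun n => delay_coef n t) (fun n => delay_op n t)).
- exact Rmult_comm.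
- intros n. apply delay_op_linear.
Qed.

Lemma delay_sum_commute (M : nat) (t u : R) (x : E) :
  T u (delay_sum M t x) = delay_sum M t (T u x).
Proof.
unfold delay_sum. rewrite (linear_sum_n _ (T_linear u)). apply sum_n_ext. intros n.
now rewrite (linear_scal _ (T_linear u)) delay_op_commute.
Qed.

(* In this form the coefficient is visibly continuous at [t = n tau]. For [n = 0]
   the identity fails when [t < 0]. *)
Lemma delay_coef_pos_part (n : nat) (t : R) :
  0 <= t ->
  delay_coef n t = (((t - INR n * tau) + Rabs (t - INR n * tau)) / 2) ^ n / INR (fact n).
Proof.
intros Ht. unfold delay_coef, indicator_ge.
destruct (Rle_dec (INR n * tau) t) as [H|H].
- rewrite -> Rabs_pos_eq by lra.
  replace ((t - INR n * tau + (t - INR n * tau)) / 2) with (t - INR n * tau) by field. ring.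
- rewrite -> Rabs_left by lra.
  replace ((t - INR n * tau + - (t - INR n * tau)) / 2) with 0 by field.
  destruct n as [|n].
  + simpl in H. lra.
  + rewrite -> pow_i by lia. unfold Rdiv. ring.
Qed.

Lemma delay_sum_continuous (M : nat) (t : R) (x : E) :
  0 <= t ->
  filterlim (fun s => delay_sum M s x) (within (fun s => 0 <= s) (locally t))
    (locally (delay_sum M t x)).
Proof.
intros Ht.
assert (Hterm : forall n, filterlim (fun s => scal (delay_coef n s) (delay_op n s x))
  (within (fun s => 0 <= s) (locally t)) (locally (scal (delay_coef n t) (delay_op n t x)))).
{ intros n.
  set (c := fun t => (((t - INR n * tau) + Rabs (t - INR n * tau)) / 2) ^ n / INR (fact n)).
  apply filterlim_within_ext with (fun s => scal (c s) (delay_op n s x)).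
  { intros s Hs. now rewrite (delay_coef_pos_part n s Hs). }
  rewrite (delay_coef_pos_part n t Ht).
  eapply filterlim_filter_le_1; [apply filter_le_within|].
  apply: (continuous_scal c (fun s => delay_op n s x)).
  - apply continuity_pt_filterlim. unfold c. reg.
  - apply: (continuous_comp (fun s => T (s - INR n * tau) x) (Nat.iter n A1)).
    + apply: (continuous_comp (fun s => s - INR n * tau) (fun s => T s x));
        [|apply T_continuous].
      apply: (continuous_minus (fun s => s)); [apply continuous_id|apply continuous_const].
    + apply: linear_cont. now apply is_linear_iter. }
unfold delay_sum. induction M as [|M IH].
- rewrite sum_O. eapply filterlim_ext; [|exact (Hterm 0%nat)].
  intros s. now rewrite sum_O.
- rewrite sum_Sn. eapply filterlim_ext; [|exact: (filterlim_plus_fun _ _ _ _ IH (Hterm (S M)))].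
  intros s. simpl. now rewrite sum_Sn.
Qed.

Lemma delay_solution_linear (t : R) : is_linear (delay_solution t).
Proof. apply delay_sum_linear. Qed.

Lemma delay_solution_history (t : R) (x : E) : t < 0 -> delay_solution t x = zero.
Proof.
intros Ht. rewrite -> (delay_solution_sum 0) by (simpl; lra).
unfold delay_sum, delay_coef. rewrite sum_O. rewrite -> indicator_ge_0 by (simpl; lra).
rewrite Rmult_0_r. apply: scal_zero_l.
Qed.

Lemma delay_solution_0 (x : E) : delay_solution 0 x = x.
Proof.
rewrite -> (delay_solution_sum 0) by (simpl; lra).
rewrite -> delay_sum_poly by (simpl; lra). unfold delay_poly. rewrite sum_O. unfold delay_op. simpl.
replace (0 - 0 * tau) with 0 by ring. replace (1 / 1) with 1 by field.
rewrite T_0. apply: scal_one.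
Qed.

Lemma delay_floor (t : R) : 0 <= t -> exists M, INR M * tau <= t < INR (S M) * tau.
Proof.
intros Ht. destruct (nfloor_ex (t / tau)) as [M [H1 H2]].
- apply Rmult_le_pos; [easy|]. left. now apply Rinv_0_lt_compat.
- exists M. rewrite S_INR.
  replace t with (t / tau * tau) by (field; lra). split.
  + apply Rmult_le_compat_r; lra.
  + apply Rmult_lt_compat_r; lra.
Qed.

Lemma delay_solution_continuous (t : R) (x : E) :
  0 <= t ->
  filterlim (fun s => delay_solution s x) (within (fun s => 0 <= s) (locally t))
    (locally (delay_solution t x)).
Proof.
intros Ht. destruct (delay_floor t Ht) as [M [_ HM]].
rewrite (delay_solution_sum M t x HM).
(* The same [M] serves every [s] near [t], on both sides: where [s < M tau] the surplus terms
   vanish. *)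
eapply filterlim_ext_loc; [|exact (delay_sum_continuous M t x Ht)].
apply filter_le_within.
eapply filter_imp; [|exact (open_lt (INR (S M) * tau) t HM)].
intros s Hs. symmetry. now apply delay_solution_sum.
Qed.

Lemma delay_solution_orbit (x : E) : D x -> is_delay_orbit (fun t => delay_solution t x).
Proof.
intros Hx. repeat split.
- intros t Ht. now apply delay_solution_history.
- intros t Ht. now apply delay_solution_continuous.
- apply generator_commute; [apply delay_solution_linear| |easy].
  intros u y. apply delay_sum_commute.
- destruct (delay_floor t H) as [M [HM1 HM2]].
  (* [A] moves inside the solution, [A (u t)] becoming the solution started at [A x], the form in
     which [delay_poly_derive] produces it. *)
  rewrite (proj2 (generator_commute (delay_solution t) x (delay_solution_linear t)
    (fun u y => delay_sum_commute _ _ _ _) Hx)).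
  rewrite (delay_solution_sum M t x HM2) (delay_solution_sum M t (A x) HM2) !delay_sum_poly //.
  (* For [M = 0] the lagged time is negative and the history is zero; otherwise it lies in the
     interval of index [M - 1]. *)
  assert (Hlag : delay_solution (t - tau) x =
    match M with O => zero | S m => delay_poly m (t - tau) x end).
  { destruct M as [|m].
    - apply delay_solution_history. simpl in HM2. lra.
    - rewrite S_INR in HM1. rewrite S_INR in HM2.
      rewrite -> (delay_solution_sum m) by lra. apply delay_sum_poly. lra. }
  rewrite Hlag.
  pose proof (is_derive_right_quotient _ _ _ _ (delay_poly_derive M t x Hx)) as Hd.
  replace (A1 match M with O => zero | S m => delay_poly m (t - tau) x end)
    with (match M with O => zero | S m => A1 (delay_poly m (t - tau) x) end)
    by (destruct M; [now rewrite (linear_zero _ A1_linear)|easy]).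
  eapply filterlim_ext_loc; [|exact Hd].
  (* For [0 < h < (M + 1) tau - t] the time [t + h] stays in the interval of [t]. A negative [h]
     could leave it, hence the right derivative. *)
  assert (He : 0 < INR (S M) * tau - t) by lra.
  exists (mkposreal _ He). intros h Hh Hh0.
  change (Rabs (h - 0) < INR (S M) * tau - t) in Hh.
  rewrite Rminus_0_r in Hh. rewrite -> Rabs_pos_eq in Hh by lra.
  rewrite -> (delay_solution_sum M (t + h)) by lra. rewrite -> delay_sum_poly by lra.
  easy.
Qed.

End StronglyContinuousGroup.

(** * The complex case *)

Lemma realify_linear {X : CompleteNormedModule C_AbsRing} (L : X -> X) :
  is_linear L -> is_linear (U := realify X) (V := realify X) L.
Proof.
intros [Hp Hs Hn]. split; [exact Hp| |exact Hn].
intros k x. exact (Hs (RtoC k) x).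
Qed.

(** Partial sums that have reached [B] leave no error. The index [M] is the same for all [x], since
    convergence is in operator norm. *)
Lemma is_op_series_finite {X : CompleteNormedModule C_AbsRing}
  (F : nat -> X -> X) (B : X -> X) (M : nat) :
  (forall N x, (M <= N)%nat -> sum_n (fun n => F n x) N = B x) -> is_op_series X F B.
Proof.
intros H eps Heps. exists M. intros N HN x. rewrite (H N x HN).
rewrite minus_eq_zero norm_zero. apply Rmult_le_pos; [lra|apply norm_ge_0].
Qed.

Section DelayedDysonPhillips.
Variable X : CompleteNormedModule C_AbsRing.
Variable tau : R.
Variable T : R -> X -> X.
Variable D : X -> Prop.
Variables A0 A1 : X -> X.
Hypothesis Htau : 0 < tau.
Hypothesis HT : is_C0_group X T.
Hypothesis HA0 : is_generator X T D A0.
Hypothesis HA1 : is_linear A1.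
Hypothesis Hcomm : forall t x, T t (A1 x) = A1 (T t x).

Let E := realify X.
Let op := delay_op E T tau A1.
Let sol := delay_solution E T tau A1.

Lemma T_real_linear (t : R) : is_linear (U := E) (V := E) (T t).
Proof. apply realify_linear, (C0_group_linear _ _ HT). Qed.

Let T_real_continuous : forall (x : E) t, continuous (U := E) (fun s => T s x) t :=
  C0_group_continuous _ _ HT.
Let A1_real_linear : is_linear (U := E) (V := E) A1 := realify_linear A1 HA1.

(** The real lemmas give homogeneity over the reals only. The sum is convertible to one over [X]
    with coefficients under [RtoC], which is complex linear. *)
Lemma delay_solution_complex_linear (t : R) : is_linear (U := X) (V := X) (sol t).
Proof.
refine (is_linear_sum_n (K := C_AbsRing) (U := X) (V := X)
  (fun n => RtoC (delay_coef tau n t)) (fun n => op n t) _ Cmult_comm _).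
intros n. exact (is_linear_comp (U := X) (V := X) (W := X) _ _
  (C0_group_linear _ _ HT (t - INR n * tau)) (is_linear_iter A1 n HA1)).
Qed.

Lemma delay_solution_is_orbit (x : X) :
  D x -> is_delay_orbit E D A0 tau A1 (fun t => sol t x).
Proof.
exact (delay_solution_orbit E T T_real_linear (C0_group_plus _ _ HT) T_real_continuous
  D A0 (proj1 HA0) (proj2 HA0) tau Htau A1 A1_real_linear Hcomm x).
Qed.

Lemma delay_solution_fundamental : is_fundamental_solution X tau D A0 A1 sol.
Proof.
split.
- intros t _. apply delay_solution_complex_linear.
- intros t x Ht. exact (delay_solution_history E T tau Htau A1 t x (proj2 Ht)).
- exact (delay_solution_0 E T (C0_group_0 _ _ HT) tau Htau A1).
- exact (fun x t => delay_solution_continuous E T T_real_continuous tau Htau A1 A1_real_linear t x).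
- intros x t Hx. exact (proj2 (proj2 (delay_solution_is_orbit x Hx)) t).
Qed.

Lemma fundamental_solution_unique (S : R -> X -> X) :
  is_fundamental_solution X tau D A0 A1 S ->
  forall t x, 0 <= t -> S t x = sol t x.
Proof.
intros HS t x Ht.
refine (linear_eq_of_eq_domain E T T_real_linear (C0_group_0 _ _ HT) (C0_group_plus _ _ HT)
  T_real_continuous D A0 (proj1 HA0) (proj2 HA0) (S t) (sol t) _ _ _ x).
- apply realify_linear, (fundamental_linear _ _ _ _ _ _ HS). lra.
- apply realify_linear, delay_solution_complex_linear.
- intros y Hy.
  refine (delay_orbit_unique E T T_real_linear (C0_group_0 _ _ HT) (C0_group_plus _ _ HT)
    T_real_continuous D A0 (proj1 HA0) (proj2 HA0) tau Htau A1
    (fun t => S t y) (fun t => sol t y) _ (delay_solution_is_orbit y Hy) _ t Ht).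
  + split; [|split].
    * intros r. exact (fundamental_history _ _ _ _ _ _ HS r y).
    * exact (fundamental_continuous _ _ _ _ _ _ HS y).
    * intros r. exact (fundamental_equation _ _ _ _ _ _ HS y r Hy).
  + rewrite (fundamental_init _ _ _ _ _ _ HS). symmetry.
    exact (delay_solution_0 E T (C0_group_0 _ _ HT) tau Htau A1 y).
Qed.

(** * The Dyson-Phillips terms *)

Lemma delay_solution_eventual_sum (t : R) :
  0 <= t -> exists M, forall N x, (M <= N)%nat ->
  delay_sum E T tau A1 N t x = sol t x.
Proof.
intros Ht. destruct (delay_floor tau Htau t Ht) as [M [_ HM]]. exists M. intros N x HN.
unfold sol. rewrite (delay_solution_sum E T tau Htau A1 M t x HM).
now apply delay_sum_stable.
Qed.

(** Stated for every real [t], the integral being oriented, so that the induction hypothesis applies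
    at [s - tau] under the integral. *)
Lemma dyson_phillips_eq (n : nat) (t : R) (x : X) :
  dyson_phillips X T A1 tau n t x =
  scal (RtoC ((t - INR n * tau) ^ n / INR (fact n)) : C_AbsRing) (op n t x).
Proof.
revert t. induction n as [|m IH]; intros t.
- simpl. unfold op, delay_op. simpl. replace (t - 0 * tau) with t by ring.
  replace (1 / 1) with 1 by field. symmetry. apply: scal_one.
- set (c := fun s => (s - INR (S m) * tau) ^ S m / INR (fact (S m))).
  set (c' := fun s => (s - tau - INR m * tau) ^ m / INR (fact m)).
  set (v := op (S m) t x : E).
  assert (Hint : is_RInt (V := E) (fun s => scal (c' s) v) (INR (S m) * tau) t
    (minus (scal (c t) v) (scal (c (INR (S m) * tau)) v))).
  { apply: (is_RInt_derive (V := E) (fun s => scal (c s) v)).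
    - intros s _. apply: is_derive_scal_l. unfold c'.
      replace (s - tau - INR m * tau) with (s - INR (S m) * tau) by (rewrite S_INR; ring).
      apply is_derive_pow_fact.
    - intros s _. apply: (continuous_scal_l c' v).
      apply continuity_pt_filterlim. unfold c'. reg. }
  (* The exponent [S m] is positive, so the antiderivative vanishes at the lower limit. *)
  assert (Hc : c (INR (S m) * tau) = 0).
  { unfold c. rewrite Rminus_diag. rewrite -> pow_i by lia. unfold Rdiv. ring. }
  rewrite Hc (scal_zero_l (K := R_AbsRing) v) minus_zero_r in Hint.
  change (dyson_phillips X T A1 tau (S m) t x) with
    (RInt (V := E) (fun s => T (t - s) (A1 (dyson_phillips X T A1 tau m (s - tau) x)))
      (INR (S m) * tau) t).
  refine (eq_trans _ (is_RInt_unique (V := E) _ _ _ _ Hint)).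
  refine (RInt_ext (V := E) _ _ _ _ _). intros s _.
  (* Once [T (t - s)] has passed [A1], it composes with [T (s - tau - m tau)] and [s] cancels,
     leaving the fixed vector [v]. *)
  rewrite IH Hcomm (linear_scal _ (C0_group_linear _ _ HT _)) (linear_scal _ HA1).
  change (scal (RtoC (c' s) : C_AbsRing) (A1 (T (t - s) (op m (s - tau) x)))
    = scal (RtoC (c' s) : C_AbsRing) (op (S m) t x)).
  apply f_equal. unfold op, delay_op. simpl. apply f_equal.
  rewrite (iter_commute E T A1 Hcomm) -(C0_group_plus _ _ HT).
  apply f_equal, (f_equal (fun r => T r x)).
  change (match m with O => 1 | S _ => INR m + 1 end) with (INR (S m)).
  rewrite S_INR. ring.
Qed.

(** * The closed form and the inverse of [T tau] *)

Lemma op_inv_group (y : X) : op_inv X (T tau) y = T (- tau) y.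
Proof.
(* [iota] is determined by a unique solution: the group law makes [T (- tau) y] the only preimage of
   [y], then shows that it is one. *)
apply iota_unique.
- intros z <-. rewrite -(C0_group_plus _ _ HT) Rplus_opp_l. symmetry. apply HT.
- rewrite -(C0_group_plus _ _ HT) Rplus_opp_r. apply HT.
Qed.

Lemma iter_op_inv (n : nat) (x : X) :
  Nat.iter n (fun y => A1 (op_inv X (T tau) y)) x = Nat.iter n A1 (T (- (INR n * tau)) x).
Proof.
induction n as [|n IH].
- simpl. rewrite Rmult_0_l Ropp_0. symmetry. apply HT.
- change (A1 (op_inv X (T tau) (Nat.iter n (fun y => A1 (op_inv X (T tau) y)) x))
    = A1 (Nat.iter n A1 (T (- (INR (S n) * tau)) x))).
  rewrite IH op_inv_group (iter_commute E T A1 Hcomm) -(C0_group_plus _ _ HT).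
  do 2 apply f_equal. apply (f_equal (fun r => T r x)). rewrite S_INR. ring.
Qed.

Lemma closed_form_term_eq (n : nat) (t : R) (x : X) :
  closed_form_term X T A1 tau t n x =
  scal (RtoC (delay_coef tau n t) : C_AbsRing) (Nat.iter n A1 (T (- (INR n * tau)) x)).
Proof. unfold closed_form_term. now rewrite iter_op_inv. Qed.

Lemma closed_form_term_group (n : nat) (t : R) (x : X) :
  closed_form_term X T A1 tau t n (T t x) =
  scal (RtoC (delay_coef tau n t) : C_AbsRing) (op n t x).
Proof.
rewrite closed_form_term_eq -(C0_group_plus _ _ HT). unfold op, delay_op.
now rewrite Rplus_comm.
Qed.

Lemma closed_form_term_commute (n : nat) (t u : R) (x : X) :
  T u (closed_form_term X T A1 tau t n x) = closed_form_term X T A1 tau t n (T u x).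
Proof.
rewrite !closed_form_term_eq (linear_scal _ (C0_group_linear _ _ HT u)).
rewrite (iter_commute E T A1 Hcomm). do 2 apply f_equal.
now rewrite -!(C0_group_plus _ _ HT) Rplus_comm.
Qed.

(** The partial sum at the stable index [M] serves as the operator [B] in the factorisation with
    [T t] on the left. *)
Lemma closed_form_sum_stable (t : R) :
  0 <= t -> exists M, forall N x, (M <= N)%nat ->
  sum_n (fun n => closed_form_term X T A1 tau t n x) N =
  sum_n (fun n => closed_form_term X T A1 tau t n x) M.
Proof.
intros Ht. destruct (delay_floor tau Htau t Ht) as [M [_ HM]]. exists M. intros N x HN.
apply sum_n_stable; [easy|]. intros n Hn. rewrite closed_form_term_eq.
rewrite -> (delay_coef_0 tau Htau M) by easy. apply: scal_zero_l.
Qed.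

Lemma closed_form_sum_linear (N : nat) (t : R) :
  is_linear (fun x => sum_n (fun n => closed_form_term X T A1 tau t n x) N).
Proof.
eapply is_linear_ext; [intros x; apply sum_n_ext; intros n; symmetry; apply closed_form_term_eq|].
apply: (is_linear_sum_n _ (fun n x => Nat.iter n A1 (T (- (INR n * tau)) x))).
- exact Cmult_comm.
- intros n. apply: (is_linear_comp (T (- (INR n * tau)))); [apply HT|now apply is_linear_iter].
Qed.

End DelayedDysonPhillips.

Theorem theorem8 (X : CompleteNormedModule C_AbsRing) (tau : R)
  (T : R -> X -> X) (D : X -> Prop) (A0 A1 : X -> X)
  (Htau : 0 < tau)
  (HT : is_C0_group X T)
  (HA0 : is_generator X T D A0)
  (HA1 : is_linear A1)
  (Hcomm : forall (t : R) (x : X), T t (A1 x) = A1 (T t x)) :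
  (exists S : R -> X -> X, is_fundamental_solution X tau D A0 A1 S) /\
  (forall S : R -> X -> X, is_fundamental_solution X tau D A0 A1 S ->
   forall t : R, 0 <= t ->
     is_op_series X
       (fun n x => scal (RtoC (indicator_ge t (INR n * tau)) : C_AbsRing)
                     (dyson_phillips X T A1 tau n t x))
       (S t) /\
     is_op_series X
       (fun n x => closed_form_term X T A1 tau t n (T t x)) (S t) /\
     (exists B : X -> X,
        is_linear B /\
        is_op_series X (closed_form_term X T A1 tau t) B /\
        forall x : X, S t x = T t (B x))).
Proof.
split.
{ exists (delay_solution (realify X) T tau A1).
  now apply delay_solution_fundamental. }
intros S HS t Ht.
destruct (delay_solution_eventual_sum X tau T A1 Htau t Ht) as [M HM].
destruct (closed_form_sum_stable X tau T A1 Htau HT Hcomm t Ht) as [M' HM'].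
assert (Hterm : forall n x, closed_form_term X T A1 tau t n (T t x) =
  scal (RtoC (delay_coef tau n t) : C_AbsRing) (delay_op (realify X) T tau A1 n t x)).
{ intros n x. now apply closed_form_term_group. }
assert (Hsum : forall N x, (M <= N)%nat ->
  sum_n (fun n => closed_form_term X T A1 tau t n (T t x)) N = S t x).
{ intros N x HN. rewrite (sum_n_ext _ _ _ (fun n => Hterm n x)).
  rewrite (fundamental_solution_unique X tau T D A0 A1 Htau HT HA0 HA1 Hcomm S HS t x Ht).
  exact (HM N x HN). }
split; [|split].
- apply (is_op_series_finite _ _ M). intros N x HN. rewrite -(Hsum N x HN).
  apply sum_n_ext. intros n. rewrite Hterm (dyson_phillips_eq X tau T A1 HT HA1 Hcomm).
  rewrite scal_assoc. apply (f_equal (fun c => scal c _)).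
  unfold delay_coef. rewrite RtoC_mult. apply Cmult_comm.
- now apply (is_op_series_finite _ _ M).
- exists (fun x => sum_n (fun n => closed_form_term X T A1 tau t n x) M'). split; [|split].
  + exact (closed_form_sum_linear X tau T A1 HT HA1 Hcomm M' t).
  + now apply (is_op_series_finite _ _ M').
  (* The series for [S t] and for [B] stabilise at possibly different indices; they are compared at
     the larger one. *)
  + intros x. rewrite -(HM' (max M M') x (Nat.le_max_r M M')).
    rewrite (linear_sum_n _ (C0_group_linear _ _ HT t)) -(Hsum (max M M') x (Nat.le_max_l M M')).
    apply sum_n_ext. intros n. symmetry. now apply closed_form_term_commute.
Qed.
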